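(* Let $f$ satisfy Assumption A with constant $b>0$, let $(\chi_n)_{n\ge 1}$ satisfy Assumption B, let $x^*\in (f(0),f(b))$ be an arbitrary point, let $\nu=\nu(x^* )=\Phi(f^{-1}(x^* ))$, and let $x_0>0$ be an arbitrary initial value. Then for any $\varepsilon>0$ there exists $\ell(\varepsilon)>0$ such that for each $\ell$ with $0<\ell<\ell(\varepsilon)$ there is a (nonrandom) positive integer $N_1=N_1(\varepsilon,\ell,x_0)$ such that the solution $(x_n)$ of $$x_{n+1}=f\big((\nu+\ell\chi_{n+1})x_n\big),\qquad n=0,1,2,\dots,$$ with initial value $x_0$ satisfies, almost surely, $x_n\in(x^*-\varepsilon,x^*+\varepsilon)$ for all $n\ge N_1$.
   Context: Assumption A (on $f$ and $b$): $f:[0,\infty)\to[0,\infty)$ is continuous, and $b>0$ is a real number such that $f$ is strictly increasing on $(0,b]$, $f(x)/x$ is strictly decreasing on $(0,b]$, $f(b)>b$, and $f(b)/b>f(x)/x$ for all $x\in(b,\infty)$. Assumption B (on the noise): on a complete probability space, $(\chi_n)_{n\ge1}$ is a sequence of independent identically distributed random variables with zero mean, having a density $\phi$ with $\phi(x)>0$ for $x\in[-1,1]$ and $\phi(x)=0$ for $x\notin[-1,1]$. Notation: $f^{-1}:[f(0),f(b)]\to[0,b]$ is the inverse of the restriction of $f$ to $[0,b]$. $\Phi(z):=z/f(z)$ for $z\in(0,b]$.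
   Formalization: The formal theorem adds to Assumption A the hypothesis that if f(0)=0 then f(x)>0 for all x>b; without it the claim fails, since for some initial values x_0 the solution can be sent to 0, or arbitrarily close to 0, in one step. *)

(* Defs.v *)
From HB Require Import structures.
From mathcomp Require Import all_boot all_order all_algebra.
From mathcomp Require Import all_classical all_reals all_analysis.

Set Implicit Arguments.
Unset Strict Implicit.
Unset Printing Implicit Defensive.

Import Order.TTheory GRing.Theory Num.Theory.
Import numFieldNormedType.Exports.

Local Open Scope classical_set_scope.
Local Open Scope ring_scope.

(* A map [0, +oo[ -> [0, +oo[ is a total f : R -> R of which only the
   restriction to [0, +oo[ is constrained. *)
Record assumptionA (R : realType) (f : R -> R) (b : R) : Prop := AssumptionA {
  A_continuous : {within `[0, +oo[, continuous f} ;
  A_nneg : forall x, 0 <= x -> 0 <= f x ;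
  A_b_gt0 : 0 < b ;
  A_increasing : {in `]0, b] &, {homo f : x y / x < y}} ;
  A_ratio_decreasing :
    {in `]0, b] &, forall x y, x < y -> f y / y < f x / x} ;
  A_fb_gt : b < f b ;
  A_ratio_tail : forall x, b < x -> f x / x < f b / b }.

(* If f 0 = 0, then 0 is a fixed point of every controlled map
   x |-> f ((nu + l * c) * x).  Should f also vanish at some z > b, solutions
   started at z / nu come, with positive probability, arbitrarily close to 0
   after one step, and no deterministic time bounds their entrance into a
   neighborhood of a positive point.  Nothing is required when f 0 > 0; on
   ]0, b] positivity of f follows from strict monotonicity. *)
Definition no_return_to_zero (R : realType) (f : R -> R) (b : R) : Prop :=
  f 0 = 0 -> forall x, b < x -> 0 < f x.

Definition independent_RVs d (T : measurableType d) (R : realType)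
    (P : probability T R) (I : choiceType) (D : set I)
    (X : I -> {RV P >-> R}) : Prop :=
  forall (s : seq I) (B : I -> set R), uniq s -> [set` s] `<=` D ->
    (forall i, measurable (B i)) ->
    P (\big[setI/setT]_(i <- s) (X i @^-1` B i)) =
    (\prod_(i <- s) P (X i @^-1` B i))%E.

Definition has_density d (T : measurableType d) (R : realType)
    (P : probability T R) (X : {RV P >-> R}) (phi : R -> R) : Prop :=
  [/\ measurable_fun setT phi, forall x, 0 <= phi x &
      forall B, measurable B ->
        distribution P X B = (\int[lebesgue_measure]_(x in B) (phi x)%:E)%E].

(* The noise sequence is indexed from 1: chi 0 is unconstrained and never used.
   The mean being 0 entails integrability, since 'E_P[X] is -oo or +oo for a
   real-valued random variable X which is not integrable. *)
Record assumptionB d (T : measurableType d) (R : realType)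
    (P : probability T R) (chi : nat -> {RV P >-> R}) (phi : R -> R) : Prop :=
  AssumptionB {
  B_complete : measure_is_complete P ;
  B_independent : independent_RVs [set n | (0 < n)%N] chi ;
  B_identical : forall m n B, (0 < m)%N -> (0 < n)%N -> measurable B ->
    distribution P (chi m) B = distribution P (chi n) B ;
  B_mean : forall n, (0 < n)%N -> ('E_P[chi n] = 0)%E ;
  B_density : forall n, (0 < n)%N -> has_density (chi n) phi ;
  B_density_gt0 : forall x, x \in `[-1, 1] -> 0 < phi x ;
  B_density_eq0 : forall x, x \notin `[-1, 1] -> phi x = 0 }.

(* Meaningful on [f 0, f b], where f is a bijection from [0, b]; elsewhere it
   takes the default value 0. *)
Definition f_inv (R : realType) (f : R -> R) (b : R) : R -> R :=
  'pinv_(fun=> 0) `[0, b] f.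

Definition Phi (R : realType) (f : R -> R) (z : R) : R := z / f z.

Fixpoint noisy_pf (R : realType) (T : Type) (f : R -> R) (nu l : R)
    (chi : nat -> T -> R) (x0 : R) (n : nat) (w : T) : R :=
  match n with
  | 0%N => x0
  | m.+1 => f ((nu + l * chi m.+1 w) * noisy_pf f nu l chi x0 m w)
  end.

(* Main.v *)
(* The noise lies in [-1, 1] almost surely, and on that event the result is
   deterministic.  Let z = f^-1(x* ), pick z1 < z < z2 in ]0, b[ with f z1 and f z2
   within eps of x*, and take l so small that
   Phi z1 < nu - l and nu + l < Phi z2.  As f(y)/y decreases, one step satisfies
   f(u x) <= max(f z2, q x) with q = (nu + l) / Phi z2 < 1 and, once u x <= b,
   f(u x) >= min(f z1, r x) with r = (nu - l) / Phi z1 > 1.  The orbit is thus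
   driven geometrically into [f z1, f z2]; the time this takes is uniform
   because the states reachable at the start of the growth phase are bounded
   below by a positive constant. *)
Require Import Defs.
From HB Require Import structures.
From mathcomp Require Import all_boot all_order all_algebra.
From mathcomp Require Import all_classical all_reals all_analysis.
From mathcomp Require Import lra.

Set Implicit Arguments.
Unset Strict Implicit.
Unset Printing Implicit Defensive.

Import Order.TTheory GRing.Theory Num.Theory.
Import numFieldNormedType.Exports.

Local Open Scope classical_set_scope.
Local Open Scope ring_scope.

(** * Geometric growth and decay of real sequences *)

(** Bernoulli's inequality bounds the powers below by an affine function of the exponent, and the
    reals are archimedean. *)
Lemma geometric_unbounded (R : realType) (c r a : R) : 1 < r -> 0 < a ->
  exists k, c <= r ^+ k * a.
Proof.
move=> r1 a0; have r10 : 0 < (r - 1) * a by rewrite mulr_gt0 // subr_gt0.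
have bern k : 1 + k%:R * (r - 1) <= r ^+ k.
  elim: k => [|k IH]; first by rewrite mul0r addr0 expr0.
  rewrite exprS -natr1; apply: (le_trans _ (ler_wpM2l _ IH)); last by lra.
  have : 0 <= k%:R * (r - 1) ^+ 2 by rewrite mulr_ge0 // sqr_ge0.
  by lra.
set t := c / ((r - 1) * a); exists (Num.bound `|t|).
have := ltW (le_lt_trans (ler_norm t) (archi_boundP (normr_ge0 t))).
rewrite {1}/t ler_pdivrMr // => le_c.
apply: (le_trans le_c); rewrite mulrA ler_pM2r //.
by apply: le_trans (bern _); rewrite lerDr.
Qed.

(** Since [c <= r * c], the bound [min c (r ^+ m * a)] propagates by induction. The time [k] is
    chosen before the sequence, which later makes it nonrandom. *)
Lemma ge_of_geometric_growth (R : realType) (c r a : R) :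
    1 < r -> 0 < a -> 0 < c ->
  exists k, forall x : nat -> R, a <= x 0 ->
    (forall n, Num.min c (r * x n) <= x n.+1) ->
    forall n, (k <= n)%N -> c <= x n.
Proof.
move=> r1 a0 c0; have [k hk] := geometric_unbounded c r1 a0.
exists k => x ax step n kn.
have r0 : 0 < r by lra.
have low m : Num.min c (r ^+ m * a) <= x m.
  elim: m => [|m IH]; first by rewrite expr0 mul1r ge_min ax orbT.
  apply: le_trans (step m); rewrite le_min ge_min lexx /=.
  apply: le_trans (ler_wpM2l (ltW r0) IH).
  rewrite minr_pMr ?(ltW r0) // le_min exprS -mulrA !ge_min lexx orbT andbT.
  by apply/orP; left; rewrite ler_peMl ?ltW.
apply: le_trans (low n); rewrite le_min lexx /=; apply: (le_trans hk).
by rewrite ler_pM2r // ler_weXn2l // ltW.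
Qed.

Lemma le_of_geometric_decay (R : realType) (c q a : R) :
    0 < q < 1 -> 0 < a -> 0 < c ->
  exists k, forall x : nat -> R, x 0 <= a ->
    (forall n, x n.+1 <= Num.max c (q * x n)) ->
    forall n, (k <= n)%N -> x n <= c.
Proof.
move=> /andP[q0 q1] a0 c0.
have qV1 : 1 < q^-1 by rewrite invf_gt1.
have [k hk] := geometric_unbounded a qV1 c0.
exists k => x ax step n kn.
have upp m : x m <= Num.max c (q ^+ m * a).
  elim: m => [|m IH]; first by rewrite expr0 mul1r le_max ax orbT.
  apply: (le_trans (step m)); rewrite ge_max le_max lexx /=.
  apply: (le_trans (ler_wpM2l (ltW q0) IH)).
  rewrite maxr_pMr ?(ltW q0) // ge_max exprS -mulrA !le_max lexx orbT andbT.
  by apply/orP; left; rewrite ler_piMl ?ltW.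
apply: (le_trans (upp n)); rewrite ge_max lexx /=.
apply: (@le_trans _ _ (q ^+ k * a)).
  by rewrite ler_pM2r // ler_wiXn2l // ltW.
by move: hk; rewrite exprVn ler_pdivlMl // exprn_gt0.
Qed.

(** * Monotonicity, intermediate values and ratios under Assumption A *)

Lemma A_within (R : realType) (f : R -> R) (b x y : R) : assumptionA f b ->
  0 <= x -> {within `[x, y], continuous f}.
Proof.
move=> hA x0; apply: continuous_subspaceW (A_continuous hA) => z /=.
by rewrite !in_itv /= andbT => /andP[xz _]; apply: le_trans xz.
Qed.

(** Continuity extends the monotonicity to the left endpoint 0; passing through [y / 2] turns a weak
    inequality at 0 into a strict one. *)
Lemma A_homo (R : realType) (f : R -> R) (b x y : R) : assumptionA f b ->
  0 <= x -> x < y -> y <= b -> f x < f y.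
Proof.
move=> hA; have pos_homo u v : 0 < u -> u < v -> v <= b -> f u < f v.
  move=> u0 uv vb; apply: (A_increasing hA) => //; rewrite in_itv /=.
    by rewrite u0 (le_trans (ltW uv)).
  by rewrite vb (lt_trans u0).
rewrite le_eqVlt => /orP[/eqP <-|x0]; last exact: pos_homo.
move=> y0 yb.
have y2 : y / 2 < y by lra.
have y20 : 0 < y / 2 by lra.
apply: le_lt_trans (pos_homo _ _ y20 y2 yb).
(* If f dipped below f 0, the intermediate value (f 0 + f (y/2)) / 2 would be
   taken strictly between 0 and y/2, contradicting monotonicity there. *)
rewrite leNgt; apply/negP => dip.
have /(_ _)[|c] := @IVT _ f 0 (y / 2) ((f 0 + f (y / 2)) / 2) (ltW y20)
    (A_within hA (lexx 0)).
  by rewrite ge_min le_max; apply/andP; split; apply/orP; [right|left]; lra.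
rewrite in_itv /= !le_eqVlt => /andP[/orP[/eqP <-|c0]]; first by lra.
move=> /orP[/eqP ->|cy]; first by lra.
by have := pos_homo _ _ c0 cy (le_trans (ltW y2) yb); lra.
Qed.

Lemma A_homoW (R : realType) (f : R -> R) (b x y : R) : assumptionA f b ->
  0 <= x -> x <= y -> y <= b -> f x <= f y.
Proof.
move=> hA x0; rewrite le_eqVlt => /orP[/eqP ->//|xy] yb.
by rewrite ltW // (A_homo hA).
Qed.

Lemma A_gt0 (R : realType) (f : R -> R) (b x : R) : assumptionA f b ->
  0 < x <= b -> 0 < f x.
Proof.
move=> hA /andP[x0 xb].
exact: le_lt_trans (A_nneg hA (lexx 0)) (A_homo hA (lexx 0) x0 xb).
Qed.

Lemma A_ivt (R : realType) (f : R -> R) (b x y v : R) : assumptionA f b ->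
  0 <= x -> x < y -> f x < v < f y -> exists2 c, x < c < y & f c = v.
Proof.
move=> hA x0 xy /andP[xv vy].
have /(_ _)[|c] := @IVT _ f x y v (ltW xy) (A_within hA x0).
  by rewrite ge_min le_max (ltW xv) (ltW vy) orbT.
rewrite in_itv /= !le_eqVlt => /andP[/orP[/eqP <-|xc]].
  by move=> _ E; rewrite E ltxx in xv.
move=> /orP[/eqP ->|cy] E; first by rewrite E ltxx in vy.
by exists c; rewrite ?xc.
Qed.

(** The point [b] links the two ranges: beyond it the ratio is below [f b / b], which is at most
    [f x / x]. *)
Lemma A_ratio_le (R : realType) (f : R -> R) (b x y : R) : assumptionA f b ->
  0 < x <= b -> x <= y -> f y / y <= f x / x.
Proof.
move=> hA /andP[x0 xb]; rewrite le_eqVlt => /orP[/eqP ->//|xy].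
have to_b u : x < u -> u <= b -> f u / u <= f x / x.
  move=> xu ub; rewrite ltW // (A_ratio_decreasing hA) // in_itv /=.
    by rewrite x0.
  by rewrite ub (lt_trans x0).
have [yb|yb] := leP y b; first exact: to_b.
apply: (le_trans (ltW (A_ratio_tail hA yb))).
move: xb; rewrite le_eqVlt => /orP[/eqP ->//|xb].
exact: to_b.
Qed.

Lemma A_Phi_lt (R : realType) (f : R -> R) (b x y : R) : assumptionA f b ->
  0 < x -> x < y -> y <= b -> Phi f x < Phi f y.
Proof.
move=> hA x0 xy yb; have y0 := lt_trans x0 xy.
have fx0 : 0 < f x by apply: (A_gt0 hA); rewrite x0 (le_trans (ltW xy)).
have fy0 : 0 < f y by apply: (A_gt0 hA); rewrite y0.
rewrite /Phi -(invf_div (f x)) -(invf_div (f y)) ltf_pV2 ?posrE ?divr_gt0 //.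
by apply: (A_ratio_decreasing hA); rewrite // in_itv /= ?x0 ?y0 //
  (le_trans (ltW xy)).
Qed.

(** The intermediate value theorem supplies a preimage, and injectivity on [[0, b]] forces the
    pseudo-inverse to return it. *)
Lemma f_inv_spec (R : realType) (f : R -> R) (b v : R) : assumptionA f b ->
  f 0 < v < f b -> 0 < f_inv f b v < b /\ f (f_inv f b v) = v.
Proof.
move=> hA hv.
have [c /andP[c0 cb] fc] := A_ivt hA (lexx 0) (A_b_gt0 hA) hv.
suff -> : f_inv f b v = c by rewrite c0 cb.
rewrite /f_inv -fc pinvKV ?inE //=; last first.
  by rewrite in_itv /= !ltW.
move=> x y; rewrite !inE /= !in_itv /= => /andP[x0 xb] /andP[y0 yb] E.
by case: (ltgtP x y) => // xy;
  [have := A_homo hA x0 xy yb|have := A_homo hA y0 xy xb]; rewrite E ltxx.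
Qed.

(** * One-step estimates *)

(** Below [z] monotonicity applies; above [z], even past [b], the ratio is at most [f z / z], the
    inverse of [Phi f z]. *)
Lemma A_step_le (R : realType) (f : R -> R) (b z p u x : R) :
    assumptionA f b -> 0 < z <= b -> 0 <= u <= p -> 0 <= x ->
  f (u * x) <= Num.max (f z) (p / Phi f z * x).
Proof.
move=> hA zb /andP[u0 up] x0; have fz := A_gt0 hA zb.
have [z0 zleb] := andP zb; rewrite le_max.
have ux0 : 0 <= u * x by rewrite mulr_ge0.
have [uxz|uxz] := leP (u * x) z.
  by rewrite (A_homoW hA).
apply/orP; right; have := A_ratio_le hA zb (ltW uxz).
rewrite ler_pdivrMr ?(lt_trans z0) // => /le_trans; apply.
rewrite /Phi invf_div [p * _]mulrC -[leRHS]mulrA.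
by rewrite ler_wpM2l ?ler_wpM2r // ltW // divr_gt0.
Qed.

(** The cases are dual to those of the upper estimate, but above [z] monotonicity is available only
    up to [b], hence the bound on [u * x]. *)
Lemma A_step_ge (R : realType) (f : R -> R) (b z p u x : R) :
    assumptionA f b -> 0 < z <= b -> 0 < p <= u -> 0 <= x -> u * x <= b ->
  Num.min (f z) (p / Phi f z * x) <= f (u * x).
Proof.
move=> hA zb /andP[p0 pu]; rewrite le_eqVlt => /orP[/eqP<- _|x0 uxb].
  by rewrite !mulr0 ge_min (A_nneg hA) ?orbT.
have fz := A_gt0 hA zb.
have [z0 zleb] := andP zb; rewrite ge_min.
have ux0 : 0 < u * x by rewrite mulr_gt0 // (lt_le_trans p0).
have [uxz|uxz] := leP z (u * x).
  by rewrite (A_homoW hA) // ltW.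
apply/orP; right.
have uxb' : 0 < u * x <= b by rewrite ux0.
have := A_ratio_le hA uxb' (ltW uxz).
rewrite ler_pdivlMr //; apply: le_trans.
rewrite /Phi invf_div [p * _]mulrC -[leLHS]mulrA.
by rewrite ler_wpM2l ?ler_wpM2r ?(ltW x0) // ltW // divr_gt0.
Qed.

(** * Deterministic orbits with multipliers in a fixed interval *)

Definition controlled_orbit (R : realType) (f : R -> R) (p q : R)
    (u x : nat -> R) :=
  forall n, p <= u n <= q /\ x n.+1 = f (u n * x n).

(* At each time the set of reachable states lies in a compact subset of
   ]0, +oo[, on which f is positive. *)
Lemma reachable_bounds (R : realType) (f : R -> R) (b p q x0 : R) (n : nat) :
    assumptionA f b -> (forall x, 0 < x -> 0 < f x) ->
    0 < p <= q -> 0 < x0 ->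
  exists am : R * R, 0 < am.1 <= am.2 /\ forall u x, x 0 = x0 ->
    controlled_orbit f p q u x -> am.1 <= x n <= am.2.
Proof.
move=> hA f0 /andP[p0 pq] x00.
elim: n => [|n [[a m] /= [/andP[a0 am] H]]].
  by exists (x0, x0) => /=; rewrite x00 lexx; split=> // u x -> _; rewrite lexx.
have pa0 : 0 < p * a by rewrite mulr_gt0.
have paqm : p * a <= q * m by apply: ler_pM => //; rewrite ltW.
(* The next bounds are the extreme values of [f] on [[p * a, q * m]]; they are attained, so the
   lower one is positive. *)
have cf := @A_within _ f b (p * a) (q * m) hA (ltW pa0).
have [c cI cmin] := EVT_min paqm cf.
have [e eI emax] := EVT_max paqm cf.
exists (f c, f e) => /=; split.
  by rewrite cmin // f0 // (lt_le_trans pa0) //; move: cI; rewrite in_itv => /andP[].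
move=> u x xx0 ox; have /andP[ax xm] := H u x xx0 ox.
have [/andP[pu uq] ->] := ox n.
have uxI : u n * x n \in `[p * a, q * m].
  have u0 := le_trans (ltW p0) pu; have x0n := le_trans (ltW a0) ax.
  by rewrite in_itv /= !ler_pM // ltW.
by rewrite cmin // emax.
Qed.

Lemma controlled_orbit_ge0 (R : realType) (f : R -> R) (b p q : R)
    (u x : nat -> R) : assumptionA f b -> 0 <= p -> 0 <= x 0 ->
  controlled_orbit f p q u x -> forall n, 0 <= x n.
Proof.
move=> hA p0 x00 ox; elim=> [//|n IH]; have [/andP[pu _] ->] := ox n.
by rewrite (A_nneg hA) // mulr_ge0 // (le_trans p0).
Qed.

Lemma controlled_orbit_le (R : realType) (f : R -> R) (b z p q x0 : R) :
    assumptionA f b -> 0 < z <= b -> 0 < p <= q -> q < Phi f z -> 0 < x0 ->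
  exists N, forall u x, x 0 = x0 -> controlled_orbit f p q u x ->
    forall n, (N <= n)%N -> x n <= f z.
Proof.
move=> hA zb /andP[p0 pq] qz x00; have q0 := lt_le_trans p0 pq.
have fz := A_gt0 hA zb; have Pz := lt_trans q0 qz.
have r01 : 0 < q / Phi f z < 1 by rewrite divr_gt0 // ltr_pdivrMr // mul1r.
have [N HN] := le_of_geometric_decay r01 x00 fz.
exists N => u x xx0 ox; apply: HN => [|n]; first by rewrite xx0.
have [/andP[pu uq] ->] := ox n.
apply: (A_step_le hA) => //; first by rewrite uq (le_trans (ltW p0)).
by apply: (controlled_orbit_ge0 hA (ltW p0) _ ox); rewrite xx0 ltW.
Qed.

(** This provides the positive starting value, uniform in [u], for the growth phase. If [f 0 = 0] it
    comes from the reachable bounds at time [N]. *)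
Lemma controlled_orbit_ge_pos (R : realType) (f : R -> R) (b z p q x0 : R) :
    assumptionA f b -> no_return_to_zero f b ->
    0 < z <= b -> 0 < p <= q -> q < Phi f z -> 0 < x0 ->
  exists N, exists2 a, 0 < a & forall u x, x 0 = x0 ->
    controlled_orbit f p q u x ->
    a <= x N /\ forall n, (N <= n)%N -> x n <= f z.
Proof.
move=> hA hz zb pq qz x00; have [p0 _] := andP pq.
have [N HN] := controlled_orbit_le hA zb pq qz x00.
have := A_nneg hA (lexx 0); rewrite le_eqVlt => /orP[/eqP f0|f0].
  have fpos x : 0 < x -> 0 < f x.
    move=> xpos; have [xb|] := leP x b; last exact: hz.
    by apply: (A_gt0 hA); rewrite xpos.
  have [[a m] /= [/andP[a0 _] Ha]] := reachable_bounds N hA fpos pq x00.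
  exists N, a => // u x xx0 ox; split; last exact: HN ox.
  by have /andP[] := Ha u x xx0 ox.
(* When [f 0 > 0], one more step suffices: [x N <= f z] gives [u N * x N <= Phi f z * f z = z <= b],
   where [f] is at least [f 0]. *)
exists N.+1, (f 0) => // u x xx0 ox; split; last first.
  by move=> n /ltnW; apply: HN ox n.
have [/andP[pu uq] ->] := ox N.
have xN0 : 0 <= x N.
  by apply: (controlled_orbit_ge0 hA (ltW p0) _ ox); rewrite xx0 ltW.
have u0 := le_trans (ltW p0) pu.
have [z0 zleb] := andP zb.
apply: (A_homoW hA) => //; first by rewrite mulr_ge0.
apply: le_trans zleb; rewrite -[leRHS](divfK (lt0r_neq0 (A_gt0 hA zb))).
by rewrite ler_pM // ?(HN u x) // (le_trans uq) // ltW.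
Qed.

(** The upper bound is reached first; from then on arguments of [f] stay below [b], so the lower
    one-step estimate applies with factor [p / Phi f z1 > 1]. *)
Lemma controlled_orbit_trapped (R : realType) (f : R -> R)
    (b z1 z2 p q x0 : R) :
    assumptionA f b -> no_return_to_zero f b ->
    0 < z1 <= b -> 0 < z2 <= b -> Phi f z1 < p <= q -> q < Phi f z2 ->
    0 < x0 ->
  exists N, forall u x, x 0 = x0 -> controlled_orbit f p q u x ->
    forall n, (N <= n)%N -> f z1 <= x n <= f z2.
Proof.
move=> hA hz z1b z2b /andP[z1p pq] qz2 x00.
have f1 := A_gt0 hA z1b; have f2 := A_gt0 hA z2b.
have Pz1 : 0 < Phi f z1 by case/andP: z1b => z10 _; rewrite divr_gt0.
have p0 := lt_trans Pz1 z1p.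
have p0q : 0 < p <= q by rewrite p0.
have [N [a a0 Ha]] := controlled_orbit_ge_pos hA hz z2b p0q qz2 x00.
have r1 : 1 < p / Phi f z1 by rewrite ltr_pdivlMr // mul1r.
have [K HK] := ge_of_geometric_growth r1 a0 f1.
exists (N + K)%N => u x xx0 ox n Nn; have [axN xle] := Ha u x xx0 ox.
have NlEn : (N <= n)%N := leq_trans (leq_addr _ _) Nn.
rewrite xle // andbT -(subnKC NlEn).
apply: (HK (fun m => x (N + m)%N)); [by rewrite addn0| |by rewrite leq_subRL].
move=> m; rewrite addnS; have [/andP[pu uq] ->] := ox (N + m)%N.
have xm0 : 0 <= x (N + m)%N.
  by apply: (controlled_orbit_ge0 hA (ltW p0) _ ox); rewrite xx0 ltW.
apply: (A_step_ge hA) => //; first by rewrite p0.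
have [z20 z2leb] := andP z2b.
(* Writing [z2] as [Phi f z2 * f z2] reduces the goal to factorwise bounds. *)
apply: le_trans z2leb; rewrite -[leRHS](divfK (lt0r_neq0 f2)).
rewrite ler_pM // ?xle ?leq_addr // ?(le_trans uq) ?ltW //.
exact: lt_le_trans pu.
Qed.

(** * Almost sure range of the noise, and the conclusion *)

Lemma density_support_ae d (T : measurableType d) (R : realType)
    (P : probability T R) (X : {RV P >-> R}) (phi : R -> R) (D : set R) :
    measurable D -> has_density X phi -> (forall x, ~ D x -> phi x = 0) ->
  {ae P, forall w, D (X w)}.
Proof.
move=> mD [_ _ hX] phi0.
have mDC : measurable (~` D) by exact: measurableC.
exists (X @^-1` (~` D)); split=> //.
  by rewrite -[X in measurable X]setTI; exact: measurable_funP.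
have := hX _ mDC; rewrite integral0_eq => [//|x /phi0 ->//].
Qed.

Theorem theorem3p5 (R : realType) (f : R -> R) (b : R)
    (d : measure_display) (T : measurableType d) (P : probability T R)
    (chi : nat -> {RV P >-> R}) (phi : R -> R) (xs nu : R)
    (hA : assumptionA f b) (hz : no_return_to_zero f b)
    (hB : assumptionB chi phi)
    (hxs : f 0 < xs < f b) (hnu : nu = Phi f (f_inv f b xs)) :
  forall eps : R, 0 < eps ->
  exists2 leps : R, 0 < leps &
  forall l : R, 0 < l < leps ->
  forall x0 : R, 0 < x0 ->
  exists2 N1 : nat, (0 < N1)%N &
  {ae P, forall w, forall n, (N1 <= n)%N ->
    xs - eps < noisy_pf f nu l chi x0 n w < xs + eps}.
Proof.
move=> eps eps0.
have [] := f_inv_spec hA hxs; move: hnu.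
set z := f_inv f b xs => hnu /andP[z0 zb] fz.
have /andP[f0xs xsfb] := hxs.
(* The maximum keeps the target value within [eps] of [xs] and strictly above [f 0]; the minimum for
   [z2] is symmetric. *)
have [z1 /andP[z10 z1z] fz1] : exists2 c, 0 < c < z &
    f c = Num.max (xs - eps / 2) ((f 0 + xs) / 2).
  apply: (A_ivt hA) => //; rewrite fz lt_max gt_max.
  by apply/andP; split; [apply/orP; right|apply/andP; split]; lra.
have [z2 /andP[zz2 z2b] fz2] : exists2 c, z < c < b &
    f c = Num.min (xs + eps / 2) ((f b + xs) / 2).
  apply: (A_ivt hA) => //; first exact: ltW.
  rewrite fz gt_min lt_min.
  by apply/andP; split; [apply/andP; split|apply/orP; right]; lra.
have z1nu : Phi f z1 < nu by rewrite hnu (A_Phi_lt hA) // ltW.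
have nuz2 : nu < Phi f z2 by rewrite hnu (A_Phi_lt hA) // ltW.
(* Exactly the room needed for [nu - l] and [nu + l] to lie between [Phi f z1] and [Phi f z2],
   whatever [x0] is. *)
exists (Num.min (nu - Phi f z1) (Phi f z2 - nu)).
  by rewrite lt_min !subr_gt0 z1nu.
move=> l /andP[l0]; rewrite lt_min => /andP[l1 l2] x0 x00.
have z1b : 0 < z1 <= b by rewrite z10 ltW // (lt_trans z1z).
have z2b' : 0 < z2 <= b by rewrite (lt_trans z0) // ltW.
have hp : Phi f z1 < nu - l <= nu + l by apply/andP; split; lra.
have hq : nu + l < Phi f z2 by lra.
have [N HN] := controlled_orbit_trapped hA hz z1b z2b' hp hq x00.
(* The successor only ensures positivity. *)
exists N.+1 => //.
have chi_bd : {ae P, forall w, forall n, chi n.+1 w \in `[-1, 1]}.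
  apply: ae_foralln => n.
  apply: (density_support_ae (D := [set x | x \in `[-1, 1]]) _
    (B_density hB (ltn0Sn n))).
    exact: measurable_itv.
  by move=> x /negP; exact: B_density_eq0 hB _.
(* From here [w] is fixed, and the multipliers form an admissible deterministic control. *)
apply: filterS chi_bd => w hw n /ltnW Nn.
have ox : controlled_orbit f (nu - l) (nu + l)
    (fun n => nu + l * chi n.+1 w) (fun n => noisy_pf f nu l chi x0 n w).
  move=> m; split => //; have := hw m; rewrite in_itv /= => /andP[c1 c2].
  by rewrite lerD2l lerD2l ler_piMr ?(ltW l0) // -mulrN1 ler_pM2l // c1.
have /andP[lo hi] := HN _ _ erefl ox n Nn.
apply/andP; split.
  by apply: lt_le_trans lo; rewrite fz1 lt_max; apply/orP; left; lra.
by apply: (le_lt_trans hi); rewrite fz2 gt_min; apply/orP; left; lra.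
Qed.
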